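(* Let $(X,\mathcal A)$ be an act with countable set $\mathcal A$ of shifts, and let $\ell:\operatorname{dom}(\ell)\to X$ be a function defined on a countable subset $\operatorname{dom}(\ell)\subset X^\omega$. The following conditions are equivalent: (1) $X$ admits a shift-continuous metrizable topology $\tau$ in which every sequence $s\in\operatorname{dom}(\ell)$ converges to the point $\ell(s)$; (2) $X$ admits a shift-continuous Hausdorff topology $\tau$ in which every sequence $s\in\operatorname{dom}(\ell)$ converges to the point $\ell(s)$; (3) the following two properties hold: (3a) for any $s\in\operatorname{dom}(\ell)$, $\alpha\in\mathcal A$ and $x\in X$ with $x\ne\alpha(\ell(s))$ the set $\{n\in\omega:\alpha(s_n)=x\}$ is finite; (3b) for any sequences $s,t\in\operatorname{dom}(\ell)$ and any shifts $\alpha,\beta\in\mathcal A$ with $\alpha(\ell(s))\ne\beta(\ell(t))$ there exists a finite set $F\subset\omega$ such that $\alpha(s_n)\ne\beta(t_m)$ for any $n,m\in\omega\setminus F$.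
   Context: $X^\omega$ is the set of all sequences $s=(s_n)_{n\in\omega}$ of elements of $X$. $X^X$ denotes the monoid of all self-maps of $X$ under composition, with unit the identity map $\mathrm{id}_X$. An act is a pair $(X,\mathcal A)$ consisting of a set $X$ and a submonoid $\mathcal A\subset X^X$ (so $\mathrm{id}_X\in\mathcal A$ and $\mathcal A$ is closed under composition); the elements of $\mathcal A$ are called shifts. A topology $\tau$ on $X$ is shift-continuous if each $\alpha\in\mathcal A$ is a continuous self-map of $(X,\tau)$. *)

(* Defs.v *)
From HB Require Import structures.
From mathcomp Require Import all_boot all_order all_algebra.
From mathcomp Require Import all_classical all_reals topology.
Set Implicit Arguments.
Unset Strict Implicit.
Unset Printing Implicit Defensive.

Local Open Scope classical_set_scope.

Definition is_act (X : Type) (A : set (X -> X)) : Prop :=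
  A id /\ forall a b : X -> X, A a -> A b -> A (a \o b).

Definition shift_continuous (T : topologicalType) (A : set (T -> T)) : Prop :=
  forall a : T -> T, A a -> continuous a.

(* A value of type [Metric R T] is a metric structure, together with the
   topology it induces, on the bare carrier of T; this topology is a priori
   unrelated to the one of T, whence the equality of the two families of open
   sets. *)
Definition metrizable (R : realType) (T : topologicalType) : Prop :=
  exists d : Metric R T, @open T = @open (Metric.Pack d).

Definition sequences_converge (T : topologicalType) (D : set (nat -> T))
    (l : set_type D -> T) : Prop :=
  forall s : set_type D, set_val s @ \oo --> l s.

(* The topology ranges over the topological structures on the fixed set X:
   [Topological X] is the type of these structures, and [Topological.Pack tau]
   is the resulting space, whose carrier is X by conversion. *)
Definition admits_topology (X : Type) (A : set (X -> X))
    (D : set (nat -> X)) (l : set_type D -> X)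
    (P : topologicalType -> Prop) : Prop :=
  exists tau : Topological X,
    let T : topologicalType := Topological.Pack tau in
    [/\ P T, @shift_continuous T A & @sequences_converge T D l].

(* Main.v *)
Require Import Defs.
From HB Require Import structures.
From mathcomp Require Import all_boot all_order all_algebra.
From mathcomp Require Import all_classical all_reals topology.

(* Conditions (3a) and (3b) say that the countable family C of sequences a o s,
   with limits a (l s), takes each value other than its limit finitely often and
   that members with distinct limits have disjoint tails. For x <> y one grows
   disjoint sets V containing x and W containing y, starting from the singletons
   and absorbing at stage n the limit and a tail of the n-th sequence of C into
   one of them; both stay sequentially closed, which is why a tail disjoint from
   the other set always exists. The union U of the sets V separates x from y, and
   every sequence of C is eventually on the side of U where its limit lies.
   Countably many such U, together with a relation isolating the points outside
   the countable set of terms and limits, give countably many equivalence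
   relations; pulled back along all shifts they define an ultrametric for which
   the shifts are continuous. *)

Local Open Scope classical_set_scope.

Lemma near_not_finite_set (P : set nat) :
  (\forall n \near \oo, ~ P n) <-> finite_set P.
Proof.
split=> [[N _ NP]|/finite_fsetP[F PF]].
  apply: (@sub_finite_set _ _ `I_N) => [n Pn|]; last exact: finite_II.
  by rewrite /= ltnNge; apply/negP => /NP /(_ Pn).
exists (\max_(i <- finmap.enum_fset F) i).+1 => // n /= Fn; rewrite PF /= => nF.
by move: (@leq_bigmax_seq _ _ xpredT id n nF isT); rewrite leqNgt Fn.
Qed.

Lemma countable_enum {T} (C : set T) : countable C -> C !=set0 ->
  exists e : nat -> T, C = range e.
Proof.
move=> /pfcard_geP[->[]//|/surjfunPex[e eC] _]; by exists e.
Qed.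

(** * Separation of two points by a set compatible with countably many sequences *)

Section separation.
Context {X : Type} (C : set ((nat -> X) * X)).
Hypothesis countC : countable C.
Hypothesis avoidC : forall c x, C c -> x <> c.2 ->
  \forall n \near \oo, c.1 n <> x.
Hypothesis disjC : forall c d, C c -> C d -> c.2 <> d.2 ->
  exists N, forall n m, N <= n -> N <= m -> c.1 n <> d.1 m.

(** Eventual avoidance amounts to closure under limits of all subsequences of members of [C], not
    only of the full sequences. *)
Let seq_closed (W : set X) := forall c, C c -> ~ W c.2 ->
  \forall n \near \oo, ~ W (c.1 n).

Let tail (c : (nat -> X) * X) N : set X :=
  [set x | x = c.2 \/ exists2 n, N <= n & x = c.1 n].

(** When [d.2] lies outside the tail, [disjC] handles the terms of [c] from some index [M] on; there
    remain [c.2] and finitely many earlier terms, each avoided through [avoidC]. *)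
Lemma seq_closed_tail c N : C c -> seq_closed (tail c N).
Proof.
move=> Cc d Cd dNc.
have dc : c.2 <> d.2 by move=> cd; apply: dNc; left.
have [M cdM] := disjC d c Cd Cc (fun e => dc (esym e)).
have dM : \forall n \near \oo, forall m : 'I_M, N <= m -> d.1 n <> c.1 m.
  apply: filter_forall => m; have [Nm|] := leqP N m; last first.
    by move=> _; near=> n.
  near=> n => _; near: n; apply: avoidC => // cmd.
  by apply: dNc; right; exists m.
near=> n; move=> [|[m Nm dncm]].
  by near: n; apply: avoidC.
have [Mm|mM] := leqP M m; last first.
  by apply: (near dM n _ (Ordinal mM)).
by move: dncm; apply: cdM => //; near: n; exists M.
Unshelve. all: by end_near. Qed.

Let absorbed (W : set X) (c : (nat -> X) * X) :=
  W c.2 /\ \forall n \near \oo, W (c.1 n).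

(** Since [W] is sequentially closed, some tail of [c] misses it; joining this tail to [V] keeps
    disjointness, and a union of two sequentially closed sets is sequentially closed. *)
Lemma absorb_tail V W c : seq_closed V -> seq_closed W -> V `&` W = set0 ->
  C c -> ~ W c.2 ->
  exists V', [/\ V `<=` V', seq_closed V', V' `&` W = set0 & absorbed V' c].
Proof.
move=> Vcl Wcl VW Cc Wc.
have [N _ cW] := Wcl c Cc Wc.
exists (V `|` tail c N); split.
- by move=> x; left.
- move=> d Cd /not_orP[dV dc]; near=> n; move=> [|].
    by near: n; apply: Vcl.
  by near: n; apply: seq_closed_tail.
- rewrite -subset0 => x [[Vx Wx|[->//|[n Nn -> Wx]]]].
    by have : (V `&` W) x by []; rewrite VW.
  exact: cW Wx.
- split; first by right; left.
  by exists N => // n Nn; right; right; exists n.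
Unshelve. all: by end_near. Qed.

Lemma separating_set x y : x <> y ->
  exists U : set X, [/\ U x, ~ U y &
    forall c, C c -> \forall n \near \oo, U (c.1 n) <-> U c.2].
Proof.
move=> xy; have [C0|/set0P C0] := eqVneq C set0.
  by exists [set x]; split => //= [/esym//|c]; rewrite C0.
have [e Ce] := countable_enum C countC C0.
have eC n : C (e n) by rewrite Ce; exists n.
pose inv (P : set X * set X) :=
  [/\ seq_closed P.1, seq_closed P.2 & P.1 `&` P.2 = set0].
pose next (a b : nat * {P | inv P}) :=
  let P := sval a.2 in let Q := sval b.2 in
  [/\ b.1 = a.1.+1, P.1 `<=` Q.1, P.2 `<=` Q.2 &
    absorbed Q.1 (e a.1) \/ absorbed Q.2 (e a.1)].
(* The sequence joins [V] unless its limit already lies in [W]; then disjointness keeps the limit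
   out of [V], and the roles are exchanged. *)
have nextP a : {b | next a b}.
  apply: cid; case: a => n [[V W] [/= Vcl Wcl VW]].
  have [Wc|Wc] := pselect (W (e n).2); last first.
    have [V' [VV' V'cl V'W eV']] := absorb_tail _ _ _ Vcl Wcl VW (eC n) Wc.
    have i : inv (V', W) by [].
    by exists (n.+1, exist _ _ i); split => //; left.
  have Vc : ~ V (e n).2.
    by move=> Vc; have : (V `&` W) (e n).2 by []; rewrite VW.
  have WV : W `&` V = set0 by rewrite setIC.
  have [W' [WW' W'cl W'V eW']] := absorb_tail _ _ _ Wcl Vcl WV (eC n) Vc.
  have i : inv (V, W') by split => //=; rewrite setIC.
  by exists (n.+1, exist _ _ i); split => //; right.
have i0 : inv ([set x], [set y]).
  have cl1 z : seq_closed [set z].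
    by move=> c Cc /= cz; apply: avoidC => // /esym.
  by split => //=; rewrite -subset0 => z [/= -> ].
have [f [f0 fS]] := dependent_choice nextP (0, exist _ _ i0).
have f1 n : (f n).1 = n.
  by elim: n => [|n IH]; [rewrite f0|have [->] := fS n; rewrite IH].
pose V n := (sval (f n).2).1; pose W n := (sval (f n).2).2.
have Vm n m : n <= m -> V n `<=` V m.
  elim: m => [|m IH]; first by rewrite leqn0 => /eqP ->.
  rewrite leq_eqVlt => /predU1P[->//|/IH /subset_trans]; apply.
  by have [] := fS m.
have Wm n m : n <= m -> W n `<=` W m.
  elim: m => [|m IH]; first by rewrite leqn0 => /eqP ->.
  rewrite leq_eqVlt => /predU1P[->//|/IH /subset_trans]; apply.
  by have [] := fS m.
have VW n m z : V n z -> W m z -> False.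
  move=> /(Vm _ _ (leq_maxl n m)) Vz /(Wm _ _ (leq_maxr n m)) Wz.
  have [_ _ VW0] := svalP (f (maxn n m)).2.
  by have : (V (maxn n m) `&` W (maxn n m)) z by []; rewrite /V /W VW0.
have V0 : V 0 x by rewrite /V f0.
have W0 : W 0 y by rewrite /W f0.
exists (\bigcup_n V n); split; [by exists 0|by move=> [n _ /VW]; apply; exact: W0|].
rewrite Ce => _ [n _ <-].
(* Stage [n] absorbs [e n]: if into [V], both sides of the equivalence eventually hold; if into [W],
   both fail. *)
have [_ _ _] := fS n; rewrite f1 => -[] [Un enU]; near=> m.
  by split=> _; exists n.+1 => //; near: m.
split=> -[k _ Vk]; exfalso; last exact: VW Vk Un.
by apply: VW Vk _; near: m; exact: enU.
Unshelve. all: by end_near. Qed.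

End separation.

Import Order.TTheory GRing.Theory Num.Theory.

(** * Metrics from distance functions and from equivalence relations *)

Section distance.
Local Open Scope ring_scope.
Context {R : realType} {X : Type} {d : X -> X -> R}.
Hypothesis dxx : forall x, d x x = 0.
Hypothesis d_eq0 : forall x y, d x y = 0 -> x = y.
Hypothesis d_sym : forall x y, d x y = d y x.
Hypothesis d_triangle : forall y x z, d x z <= d x y + d y z.

(** An alias to which instances can be attached; being convertible to [X], it yields a metric
    structure on [X] itself. *)
Let carrier : Type := X.

HB.instance Definition _ := gen_eqMixin carrier.
HB.instance Definition _ := gen_choiceMixin carrier.
HB.instance Definition _ :=
  isMetric.Build R carrier dxx d_eq0 d_sym d_triangle.

Lemma metric_of_distance : exists M : Metric R X, forall x (V : set X),
  @nbhs X (Metric.Pack M) x V <-> exists2 e, 0 < e & forall y, d x y < e -> V y.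
Proof.
exists (Metric.class carrier) => x V.
by rewrite (nbhs_ballP (x : carrier)).
Qed.

End distance.

Section equivalence_metric.
Local Open Scope ring_scope.
Context {R : realType} {X : Type} (q : nat -> X -> X -> Prop).
Hypothesis q_refl : forall i x, q i x x.
Hypothesis q_sym : forall i x y, q i x y -> q i y x.
Hypothesis q_trans : forall i x y z, q i x y -> q i y z -> q i x z.
Hypothesis q_sep : forall x y, (forall i, q i x y) -> x = y.

(* The distance is [1 / (i + 1)] for the least [i] such that [q i] separates the
   two points. *)
Lemma metric_of_equivalences : exists M : Metric R X, forall x (V : set X),
  @nbhs X (Metric.Pack M) x V <->
  exists n, forall y, (forall i, (i <= n)%N -> q i x y) -> V y.
Proof.
have /choice[d dP] : forall xy : X * X, exists r : R,
    (r = 0 /\ forall i, q i xy.1 xy.2) \/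
    exists i, [/\ r = i.+1%:R^-1, ~ q i xy.1 xy.2 &
      forall j, (j < i)%N -> q j xy.1 xy.2].
  move=> [x y]; have [qxy|] := pselect (forall i, q i x y).
    by exists 0; left.
  move=> /existsNP nq.
  have ex : exists i, `[< ~ q i x y >] by case: nq => i ?; exists i; apply/asboolP.
  exists (ex_minn ex).+1%:R^-1; right; case: ex_minnP => m /asboolP nqm min_m.
  exists m; split => // j jm; apply: contrapT => nqj.
  by have := min_m j (asboolT nqj); rewrite leqNgt jm.
pose dist x y := d (x, y).
have dist_ge0 x y : 0 <= dist x y.
  have [[r0 _]|[i [ri _ _]]] := dP (x, y); rewrite /dist ?r0 // ri invr_ge0.
  exact: ler0n.
have dist_le i x y : ~ q i x y -> i.+1%:R^-1 <= dist x y.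
  move=> nq; have [[_ /(_ i)]//|[j [rj _ ltj]]] := dP (x, y).
  rewrite /dist rj lef_pV2 ?posrE // ler_nat ltnS leqNgt.
  by apply/negP => /ltj.
(* Balls of radius [n.+1%:R^-1] are the classes of finite intersections of relations; strictness of
   the inequality includes the index [n] itself. *)
have distP x y n : dist x y < n.+1%:R^-1 <-> forall i, (i <= n)%N -> q i x y.
  split=> [dn i ilen|qn].
    apply: contrapT => /dist_le; rewrite leNgt (lt_le_trans dn) //.
    by rewrite lef_pV2 ?posrE // ler_nat ltnS.
  have [[r0 _]|[j [rj nqj _]]] := dP (x, y); first by rewrite /dist r0 invr_gt0.
  rewrite /dist rj ltf_pV2 ?posrE // ltr_nat ltnS ltnNge.
  by apply/negP => /qn.
have distxx x : dist x x = 0.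
  by have [[]//|[i [_ /(_ (q_refl _ _))]]] := dP (x, x).
have dist_eq0 x y : dist x y = 0 -> x = y.
  move=> d0; apply: q_sep => i; apply: contrapT => /dist_le.
  by rewrite d0 leNgt invr_gt0 ltr0Sn.
have dist_leP x y z w : (forall i, ~ q i x y -> ~ q i z w) -> dist x y <= dist z w.
  move=> h; rewrite {1}/dist.
  have [[-> _]|[i [-> nq _]]] := dP (x, y); first exact: dist_ge0.
  by apply: dist_le; exact: h.
have dist_sym x y : dist x y = dist y x.
  by apply/eqP; rewrite eq_le !dist_leP // => i nq /q_sym.
have dist_tri y x z : dist x z <= dist x y + dist y z.
  rewrite {1}/dist; have [[-> _]|[i [-> nq _]]] := dP (x, z).
    by rewrite addr_ge0 // dist_ge0.
  (* By transitivity, [q i] separates [x] from [y] or [y] from [z], so a single summand already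
     suffices. *)
  have [qxy|/dist_le xy] := pselect (q i x y).
    have /dist_le yz : ~ q i y z by move=> /(q_trans _ _ _ _ qxy).
    by rewrite (le_trans yz) // lerDr.
  by rewrite (le_trans xy) // lerDl.
have [M ME] := metric_of_distance distxx dist_eq0 dist_sym dist_tri.
exists M => x V; split=> [/ME[e e0 eV]|[n nV]].
  have [n ne] : exists n, n.+1%:R^-1 < e.
    exists (Num.truncn e^-1); rewrite invf_plt ?posrE //.
    by rewrite truncnS_gt.
  exists n => y /distP dxy; apply: eV; exact: lt_trans ne.
by apply/ME; exists n.+1%:R^-1; rewrite ?invr_gt0 // => y /distP /nV.
Qed.
End equivalence_metric.

(** * Metrizable and Hausdorff topologies *)

Lemma metrizable_hausdorff (R : realType) (T : topologicalType) :
  metrizable R T -> hausdorff_space T.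
Proof.
move=> [d openE] p q pq; apply: (@metric_hausdorff _ (Metric.Pack d)).
have nbhs_sub x V : @nbhs _ (Metric.Pack d) x V -> @nbhs _ T x V.
  by rewrite !nbhsE => -[B [Bo Bx] BV]; exists B => //; split=> //; rewrite openE.
by move=> V W /nbhs_sub pV /nbhs_sub qW; exact: pq.
Qed.

Lemma hausdorff_cvg_neq (T : topologicalType) (u v : nat -> T) (x y : T) :
  hausdorff_space T -> u @ \oo --> x -> v @ \oo --> y -> x <> y ->
  exists N, forall n m, N <= n -> N <= m -> u n <> v m.
Proof.
move=> + ux vy /eqP xy; rewrite open_hausdorff.
move=> /(_ _ _ xy)[[V W] /= [/set_mem Vx /set_mem Wy] [Vo Wo /eqP VW]].
have [N _ uV] := ux V (open_nbhs_nbhs (conj Vo Vx)).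
have [M _ vW] := vy W (open_nbhs_nbhs (conj Wo Wy)).
exists (maxn N M) => n m; rewrite !geq_max => /andP[Nn _] /andP[_ Mm] unvm.
by have : (V `&` W) (u n); [split; [exact: uV|rewrite unvm; exact: vW]|rewrite VW].
Qed.

Lemma countable_image {T U : Type} (f : T -> U) (B : set T) :
  countable B -> countable (f @` B).
Proof. exact/sub_countable/card_image_le. Qed.

(** * From the combinatorial conditions to a metrizable topology *)

Section metric_topology.
Context (R : realType) {X : Type} {A : set (X -> X)} {D : set (nat -> X)}
  {l : set_type D -> X}.
Hypotheses (actA : is_act A) (countA : countable A) (countD : countable D).
Hypothesis finite_fiber : forall (s : set_type D) (a : X -> X) (x : X),
  A a -> x <> a (l s) -> finite_set [set n : nat | a (set_val s n) = x].
Hypothesis disjoint_tails : forall (s t : set_type D) (a b : X -> X),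
  A a -> A b -> a (l s) <> b (l t) ->
  exists F : set nat, finite_set F /\
    forall n m : nat, ~ F n -> ~ F m -> a (set_val s n) <> b (set_val t m).

(** Continuity of the shifts forces each [a \o s] to converge to [a (l s)], so all these pairs are
    handled together. *)
Let C : set ((nat -> X) * X) :=
  [set (fun n => p.1 (set_val p.2 n), p.1 (l p.2)) | p in A `*` setT].

Let countC : countable C.
Proof.
apply/countable_image/countableX => //.
by rewrite (eq_countable (card_setT _)).
Qed.

Let avoidC c x : C c -> x <> c.2 -> \forall n \near \oo, c.1 n <> x.
Proof.
by move=> [[a s] [/= Aa _] <-] /= xas; apply/near_not_finite_set/finite_fiber.
Qed.

Let disjC c d : C c -> C d -> c.2 <> d.2 ->
  exists N, forall n m, N <= n -> N <= m -> c.1 n <> d.1 m.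
Proof.
move=> [[a s] [/= Aa _] <-] [[b t] [/= Ab _] <-] /= asbt.
have [F [/near_not_finite_set[N _ NF] Fdisj]] := disjoint_tails s t a b Aa Ab asbt.
by exists N => n m Nn Nm; apply: Fdisj; exact: NF.
Qed.

(** Index 0 stands for the limit and [k.+1] for the term of index [k], which makes [Y] a countable
    union of ranges. *)
Let Y : set X :=
  \bigcup_(c in C) range (fun n => if n is k.+1 then c.1 k else c.2).

(* Points outside [Y] are isolated by the relation [x = y \/ Y x /\ Y y]; inside
   [Y] countably many separating sets suffice. *)
Lemma separating_equivalences : exists q : nat -> X -> X -> Prop,
  [/\ (forall i x, q i x x), (forall i x y, q i x y -> q i y x),
      (forall i x y z, q i x y -> q i y z -> q i x z),
      (forall x y, (forall i, q i x y) -> x = y) &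
      (forall i a, A a -> exists j, forall x y, q j x y -> q i (a x) (a y)) /\
      (forall i s, \forall n \near \oo, q i (l s) (set_val s n))].
Proof.
have [Aid Acomp] := actA.
have /choice[U UP] : forall xy : X * X, exists U : set X,
    (xy.1 <> xy.2 -> U xy.1 /\ ~ U xy.2) /\
    forall c, C c -> \forall n \near \oo, U (c.1 n) <-> U c.2.
  move=> [x y]; have [->|xy] := pselect (x = y).
    by exists set0; split => // c _; near=> n.
  have [V [Vx Vy VC]] := separating_set C countC avoidC disjC x y xy.
  by exists V.
pose G x y := x = y \/ Y x /\ Y y.
(* [Q0] separates points; its pull-backs [Q] along all shifts are stable under further pull-back, as
   [A] is closed under composition. *)
pose rel_of xy x y := U xy x <-> U xy y.
pose Q0 : set (X -> X -> Prop) := G |` (rel_of @` (Y `*` Y)).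
pose Q := [set (fun x y => p.2 (p.1 x) (p.1 y)) | p in A `*` Q0].
have countY : countable Y.
  by apply: bigcup_countable => // c _; apply: countable_image.
have countQ : countable Q.
  apply/countable_image/countableX => //; rewrite /Q0 -bigcup2E.
  apply: bigcup_countable => // -[|[|n]] _ //=.
  exact/countable_image/countableX.
have Q0Q r : Q0 r -> Q r by move=> Q0r; exists (id, r).
have [q qE] := countable_enum Q countQ (ex_intro _ _ (Q0Q G (or_introl erefl))).
have qQ i : Q (q i) by rewrite qE; exists i.
have Qq r : Q r -> exists i, q i = r by rewrite qE => -[i _]; exists i.
exists q; split.
- move=> i x; have [[a r] [/= _ [->|[xy _ <-]]] <-] := qQ i => //.
  by left.
- move=> i x y; have [[a r] [/= _ [->|[xy _ <-]]] <-] := qQ i.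
    by move=> [->|[]]; [left|right].
  by case=> h h'; split.
- move=> i x y z; have [[a r] [/= _ [->|[xy _ <-]]] <-] := qQ i.
    by move=> [->//|[Yx Yy]] [<-|[_ Yz]]; right.
  by rewrite /rel_of => -> .
- move=> x y qxy.
  have Qxy r : Q0 r -> r x y by move=> /Q0Q/Qq[i <-].
  have [//|[Yx Yy]] := Qxy G (or_introl erefl).
  apply: contrapT => xy; have [/(_ xy)[/= Ux Uy] _] := UP (x, y).
  have Qr : Q0 (rel_of (x, y)) by right; exists (x, y).
  exact/Uy/(Qxy _ Qr).
- split=> [i a Aa|i s].
    have [[b r] [/= Ab Q0r] <-] := qQ i.
    have [j qj] : exists j, q j = (fun x y => r (b (a x)) (b (a y))).
      by apply: Qq; exists (b \o a, r); split => //; exact: Acomp.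
    by exists j => x y; rewrite qj.
  have [[a r] [/= Aa Q0r] <-] := qQ i.
  pose c := ((fun n => a (set_val s n)), a (l s)).
  have Cc : C c by exists (a, s).
  (* For [G], the limit and all terms of [c] lie in [Y]; for [rel_of xy], the choice of [U] gives
     eventual agreement. *)
  case: Q0r => [->|[xy _ <-]]; last first.
    have [_ /(_ c Cc) UC] := UP xy.
    by apply: filterS UC => n UC; exact: iff_sym.
  by near=> n; right; split; exists c => //; [exists 0|exists n.+1].
Unshelve. all: by end_near. Qed.

Lemma admits_metrizable : admits_topology A l (metrizable R).
Proof.
have [q [qr qs qt qsep [qA ql]]] := separating_equivalences.
have [M ME] := @metric_of_equivalences R X q qr qs qt qsep.
exists (Topological.class (Metric.Pack M)); split.
- by exists M.
- move=> a Aa x V /ME[n nV].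
  have /choice[j jP] i := qA i a Aa.
  (* Each of the first [n.+1] relations pulls back along [a] to some [q (j i)]; the largest of these
     indices bounds the relations needed at [x]. *)
  apply/ME; exists (\max_(i < n.+1) j i) => y xy.
  apply: nV => i ilen; apply/jP/xy.
  exact: (@leq_bigmax _ (fun i : 'I_n.+1 => j i) (Ordinal (ilen : i < n.+1))).
- move=> s V /ME[n nV].
  have nq : \forall m \near \oo, forall i : 'I_n.+1, q i (l s) (set_val s m).
    by apply: filter_forall => i; exact: ql.
  apply: filterS nq => m qm; apply: nV => i ilen.
  exact: (qm (Ordinal (ilen : i < n.+1))).
Qed.

End metric_topology.

Theorem theorem3p1 (R : realType) (X : Type) (A : set (X -> X))
    (D : set (nat -> X)) (l : set_type D -> X)
    (actA : is_act A) (countA : countable A) (countD : countable D) :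
  [<-> admits_topology A l (metrizable R);
       admits_topology A l (fun T => hausdorff_space T);
       (forall (s : set_type D) (a : X -> X) (x : X),
          A a -> x <> a (l s) ->
          finite_set [set n : nat | a (set_val s n) = x])
       /\
       (forall (s t : set_type D) (a b : X -> X),
          A a -> A b -> a (l s) <> b (l t) ->
          exists F : set nat, finite_set F /\
            forall n m : nat, ~ F n -> ~ F m ->
              a (set_val s n) <> b (set_val t m))].
Proof.
split; last split.
- by move=> [tau [/metrizable_hausdorff]]; exists tau.
- move=> [tau [T2 Acont lcvg]].
  pose T : topologicalType := Topological.Pack tau.
  have acvg s a : A a -> (fun n => a (set_val s n) : T) @ \oo --> (a (l s) : T).
    by move=> Aa V /(Acont a Aa (l s)) /(lcvg s).
  split=> [s a x Aa xas|s t a b Aa Ab asbt].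
    (* The constant sequence at [x] serves as the second convergent sequence. *)
    have [N NP] := @hausdorff_cvg_neq T _ _ _ _ T2 (acvg s a Aa)
      (cvg_cst (x : T)) (nesym xas).
    by apply/near_not_finite_set; exists N => // n Nn; exact: (NP n n).
  have [N NP] := @hausdorff_cvg_neq T _ _ _ _ T2 (acvg s a Aa) (acvg t b Ab) asbt.
  exists `I_N; split; first exact: finite_II.
  by move=> n m /negP nN /negP mN; apply: NP; rewrite leqNgt.
- by move=> [fin disj]; exact: admits_metrizable.
Qed.
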